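(* For any integer $d\ge 3$, there does not exist a connected graph $G$ with $g(G)=2$, $eg(G)=3$, $seg(G)=3$ and $meg(G)=d$.
   Context: All graphs are finite, simple, undirected and connected. Let $G$ be such a graph with vertex set $V(G)$ and edge set $E(G)$. - A geodetic set of $G$ is a set $S\subseteq V(G)$ such that every vertex of $G$ lies on some (at least one) shortest path between some pair of distinct vertices of $S$. The geodetic number $g(G)$ is the minimum cardinality of a geodetic set. - An edge-geodetic set of $G$ is a set $S\subseteq V(G)$ such that every edge of $G$ lies on some (at least one) shortest path between some pair of distinct vertices of $S$. The edge-geodetic number $eg(G)$ is the minimum cardinality of an edge-geodetic set. - A strong edge-geodetic set of $G$ is a set $S\subseteq V(G)$ for which one can choose, for each unordered pair of distinct vertices $u,v\in S$, one specific shortest $u$--$v$ path $P_{uv}$, such that every edge of $G$ lies on at least one of the chosen paths. The strong edge-geodetic number $seg(G)$ is the minimum cardinality of a strong edge-geodetic set. - A monitoring edge-geodetic set (MEG-set) of $G$ is a set $S\subseteq V(G)$ such that for every edge $e\in E(G)$ there is a pair of distinct vertices $u,v\in S$ such that $e$ lies on every shortest $u$--$v$ path in $G$. The monitoring edge-geodetic number $meg(G)$ is the minimum cardinality of an MEG-set. *)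

(* Defs.v *)
From mathcomp Require Import all_boot.

Set Implicit Arguments.
Unset Strict Implicit.
Unset Printing Implicit Defensive.

(* A finite simple graph is a symmetric irreflexive relation [e] on a finType
   of vertices; an edge is given by two endpoints [x], [y] with [e x y].  A
   path is the full sequence of its vertices, both ends included. *)
Section Geodetic.

Variables (T : finType) (e : rel T).

Definition simple_graph : Prop := symmetric e /\ irreflexive e.

Definition connected_graph : Prop := forall u v : T, connect e u v.

Definition is_path (u v : T) (s : seq T) : Prop :=
  [/\ ohead s = Some u, last u s = v, sorted e s & uniq s].

(* Comparing the numbers of vertices is comparing the lengths. *)
Definition shortest_path (u v : T) (s : seq T) : Prop :=
  is_path u v s /\ forall t, is_path u v t -> size s <= size t.

Definition edge_on_path (x y : T) (s : seq T) : bool :=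
  infix [:: x; y] s || infix [:: y; x] s.

Definition geodetic_set (S : {set T}) : Prop :=
  forall x : T, exists u v s,
    [/\ u \in S, v \in S, u != v, shortest_path u v s & x \in s].

Definition edge_geodetic_set (S : {set T}) : Prop :=
  forall x y : T, e x y -> exists u v s,
    [/\ u \in S, v \in S, u != v, shortest_path u v s & edge_on_path x y s].

(* The reversal condition makes [P] a choice of a single path for each
   unordered pair. *)
Definition strong_edge_geodetic_set (S : {set T}) : Prop :=
  exists P : T -> T -> seq T,
    (forall u v, u \in S -> v \in S -> u != v ->
       shortest_path u v (P u v) /\ P v u = rev (P u v)) /\
    (forall x y, e x y -> exists u v,
       [/\ u \in S, v \in S, u != v & edge_on_path x y (P u v)]).

Definition meg_set (S : {set T}) : Prop :=
  forall x y : T, e x y -> exists u v,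
    [/\ u \in S, v \in S, u != v &
        forall s, shortest_path u v s -> edge_on_path x y s].

(* Stated as a relation since the one-vertex graph has no geodetic set. *)
Definition min_card (Q : {set T} -> Prop) (k : nat) : Prop :=
  (exists2 S, Q S & #|S| = k) /\ (forall S, Q S -> k <= #|S|).

Definition geodetic_number : nat -> Prop := min_card geodetic_set.
Definition edge_geodetic_number : nat -> Prop := min_card edge_geodetic_set.
Definition strong_edge_geodetic_number : nat -> Prop :=
  min_card strong_edge_geodetic_set.
Definition meg_number : nat -> Prop := min_card meg_set.

End Geodetic.

(* Main.v *)
Require Import Defs.
From mathcomp Require Import all_boot zify.

Set Implicit Arguments.
Unset Strict Implicit.
Unset Printing Implicit Defensive.

(** A geodetic pair [u], [v] ranks every vertex by its distance to [u]: each
    vertex lies on a shortest path from [u] to [v], so the two distances add up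
    to a constant. An edge between different levels extends to a shortest path
    from [u] to [v]. As no pair of vertices is edge-geodetic, some edge [xy]
    stays inside a level ([level_edge_exists]).

    Let three shortest paths [A], [B], [C] join the pairs [ab], [ac], [bc] and
    cover all edges. No end of two paths lies on the third: if [a] were on [C],
    then [b] and [c] alone would be edge-geodetic ([between_edge_geodetic]). A
    path through [u] or [v] has no edge inside a level, because distances along
    a path count its steps, and the two ends of an edge are at distances of
    different parity from any vertex of the path. Let [C] contain [xy]; then
    [u] and [v] lie on [A] or [B] and not on [C]. They are not on the same one:
    no distance exceeds [dist u v], so [u] and [v] would be the ends of that
    path, but one of its ends is [b] or [c] and lies on [C]. Up to symmetry,
    [u] is on [A] and [v] is on [B].

    From [b] the path [A] goes straight towards [u], so a neighbour of [b]
    further from [u] is on [C]: the path [C] leaves [b] in the direction of [v],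
    and likewise leaves [c] in the direction of [u]. Hence [C] shares with the
    part of [A] from [u] to [b] no end of an edge inside a level, and similarly
    for the part of [B] from [v] to [c] ([level_edge_near_apex]). On the other
    hand [x] has a neighbour in the level below, one in the level above and
    [y]; these three are too many for [C] alone, so [x] is on [A] or [B]
    ([level_edge_branches]), and so is [y]. Both are thus on the walk from [u]
    to [a] along [A] and on to [v] along [B], which meets every level once: [x]
    and [y] coincide, a contradiction. *)

(* In the contexts below, Boolean hypotheses are memberships and disequalities
   of vertices; they carry no arithmetic but slow [lia] down a lot. *)
Ltac nat_lia := repeat match goal with H : is_true _ |- _ => clear H end; lia.

(** * Distances and shortest paths *)

Section Distance.

Variables (T : finType) (e : rel T).
Hypotheses (e_sym : symmetric e) (eirr : irreflexive e).
Hypothesis econn : connected_graph e.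

Definition walk_of_size (x y : T) (n : nat) : bool :=
  [exists t : n.-tuple T, path e x t && (last x t == y)].

Lemma walk_exists x y : exists n, walk_of_size x y n.
Proof.
have /connectP[p ep ->] := econn x y.
by exists (size p); apply/existsP; exists (in_tuple p); rewrite ep eqxx.
Qed.

Definition dist (x y : T) : nat := ex_minn (walk_exists x y).

Lemma dist_walk x y :
  exists p, [/\ path e x p, last x p = y & size p = dist x y].
Proof.
rewrite /dist; case: ex_minnP => n /existsP[t /andP[et /eqP lt]] _.
by exists t; rewrite size_tuple.
Qed.

Lemma dist_le x p : path e x p -> dist x (last x p) <= size p.
Proof.
move=> ep; rewrite /dist; case: ex_minnP => n _; apply.
by apply/existsP; exists (in_tuple p); rewrite ep eqxx.
Qed.

Lemma dist_eq0 x y : dist x y = 0 -> x = y.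
Proof. by have [[|z p] [_ <- <-]] := dist_walk x y. Qed.

Lemma distxx x : dist x x = 0.
Proof. by have := @dist_le x [::] isT; case: (dist x x). Qed.

Lemma dist_sym_le x y : dist y x <= dist x y.
Proof.
have [p [ep <- <-]] := dist_walk x y.
have := @dist_le (last x p) (rev (belast x p)).
rewrite rev_path size_rev size_belast.
have -> : last (last x p) (rev (belast x p)) = x.
  by case: p {ep} => //= z p; rewrite rev_cons last_rcons.
by apply; rewrite (eq_path (e' := e)) // => z t; rewrite e_sym.
Qed.

Lemma dist_sym x y : dist x y = dist y x.
Proof. by apply/eqP; rewrite eqn_leq !dist_sym_le. Qed.

Lemma dist_triangle x y z : dist x z <= dist x y + dist y z.
Proof.
have [p [ep lp <-]] := dist_walk x y.
have [q [eq lq <-]] := dist_walk y z.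
have := @dist_le x (p ++ q).
by rewrite cat_path last_cat size_cat lp ep eq lq; apply.
Qed.

Lemma dist_edge x y : e x y -> dist x y = 1.
Proof.
move=> exy; have := @dist_le x [:: y]; rewrite /= exy => /(_ isT) le1.
case dxy: (dist x y) le1 => [|[|n]] // _.
by move: exy; rewrite (dist_eq0 dxy) eirr.
Qed.

Lemma step_closer x y :
  x != y -> exists z, e x z /\ dist z y + 1 = dist x y.
Proof.
have [[|z p] [/= ep lp sp]] := dist_walk x y; first by rewrite -lp eqxx.
move=> _; case/andP: ep => exz ep; exists z; split=> //.
have := dist_le ep; have := dist_triangle x z y.
rewrite lp (dist_edge exz); lia.
Qed.

(** Membership in [shortest_path] asks for distinct vertices; a walk of minimal
    size has them because removing its loops cannot make it shorter. *)
Lemma shortest_walk x p :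
  path e x p -> size p = dist x (last x p) ->
  shortest_path e x (last x p) (x :: p).
Proof.
move=> ep sp; split; last first.
  move=> [|z t] [] //= [->] lt et _; rewrite ltnS sp -lt; exact: dist_le.
split=> //; have := dist_le ep; rewrite -sp; move: sp.
case: (shortenP ep) => q eq uq sub_qp sp _.
have le_pq : size p <= size q by rewrite sp; apply: dist_le.
apply: leq_size_uniq uq _ _ => // z; rewrite !inE => /orP[->//|/sub_qp ->].
exact: orbT.
Qed.

Lemma shortest_path_dist a b s : shortest_path e a b s ->
  exists p, [/\ s = a :: p, path e a p, last a p = b & size p = dist a b].
Proof.
case=> [[]]; case: s => [|z p] //= [->] lp ep _ min; exists p; split=> //.
have [q [eq lq sq]] := dist_walk a b.
have := min (a :: q); rewrite /= ltnS sq => le_p.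
apply/eqP; rewrite eqn_leq -{2}lp dist_le // andbT; apply: le_p.
rewrite -{1}lq; case: (@shortest_walk a q eq) => //; by rewrite lq.
Qed.

Lemma dist_nth_le x p i j : path e x p -> i + j <= size p ->
  dist (nth x (x :: p) i) (nth x (x :: p) (i + j)) <= j.
Proof.
move=> ep; elim: j => [|j IHj]; first by rewrite addn0 distxx.
rewrite addnS => lt_ij; have := IHj (ltnW lt_ij).
have := dist_triangle (nth x (x :: p) i) (nth x (x :: p) (i + j))
                      (nth x (x :: p) (i + j).+1).
have /= -> := dist_edge (pathP x ep _ lt_ij); lia.
Qed.

(** * Isometric lines *)

(** What the argument uses of the vertex set of a shortest path: it embeds into
    the integers without changing distances. The notion does not depend on the
    direction of the path ([line_sym]). *)
Definition line (a b : T) (A : seq T) : Prop :=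
  [/\ a \in A, b \in A,
      forall x, x \in A -> dist a x + dist x b = dist a b &
      forall x y, x \in A -> y \in A ->
        dist a y = dist a x + dist x y \/ dist a x = dist a y + dist x y].

Lemma shortest_path_line a b s : shortest_path e a b s -> line a b s.
Proof.
move=> /shortest_path_dist[p [-> ep lp sp]].
have nth_last_p : nth a (a :: p) (size p) = b by rewrite -lp (last_nth a).
have nth_dist i j : i <= j <= size p ->
  dist (nth a (a :: p) i) (nth a (a :: p) j) = j - i.
  move=> /andP[le_ij le_jp].
  have := @dist_nth_le a p 0 i ep.
  rewrite !add0n /= => /(_ (leq_trans le_ij le_jp)).
  have := @dist_nth_le a p i (j - i) ep; rewrite subnKC // => /(_ le_jp).
  have := @dist_nth_le a p j (size p - j) ep.
  rewrite subnKC // => /(_ (leqnn _)).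
  rewrite nth_last_p; have := dist_triangle a (nth a (a :: p) i) b.
  have := dist_triangle (nth a (a :: p) i) (nth a (a :: p) j) b.
  rewrite -sp; lia.
have nth0 i : i <= size p -> dist a (nth a (a :: p) i) = i.
  by move=> le_ip; rewrite (nth_dist 0 i) // subn0.
split.
- exact: mem_head.
- by rewrite -lp mem_last.
- move=> x /(nthP a)[i]; rewrite ltnS => le_ip <-.
  rewrite nth0 // -sp -{1}nth_last_p nth_dist ?le_ip //= subnKC //.
- move=> x y /(nthP a)[i]; rewrite ltnS => le_ip <- /(nthP a)[j].
  rewrite ltnS => le_jp <-; rewrite !nth0 //.
  case: (leqP i j) => [le_ij|/ltnW le_ji]; [left|right].
    by rewrite nth_dist ?le_ij //; lia.
  by rewrite dist_sym nth_dist ?le_ji //; lia.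
Qed.

Lemma line_sym a b A : line a b A -> line b a A.
Proof.
case=> aA bA ab lin; split=> //.
  move=> x /ab; rewrite (dist_sym b x) (dist_sym x a) (dist_sym b a); nat_lia.
move=> x y xA yA; have := lin x y xA yA; have := ab x xA; have := ab y yA.
rewrite (dist_sym b x) (dist_sym b y); nat_lia.
Qed.

Lemma line_inj a b A x y : line a b A -> x \in A -> y \in A ->
  dist a x = dist a y -> x = y.
Proof.
case=> _ _ _ lin xA yA eq_axy; apply: dist_eq0; have := lin x y xA yA; nat_lia.
Qed.

(** The neighbours of [x] are one step closer to [a] or one step further than
    [x]: there are two values for three distances to [a]. *)
Lemma line_degree_le2 a b A x y z w : line a b A ->
  x \in A -> y \in A -> z \in A -> w \in A -> e x y -> e x z -> e x w ->
  [\/ y = z, y = w | z = w].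
Proof.
move=> lA xA yA zA wA exy exz exw; have [_ _ _ lin] := lA.
have := line_inj lA yA zA; have := line_inj lA yA wA; have := line_inj lA zA wA.
case: (lin x y xA yA) (lin x z xA zA) (lin x w xA wA).
all: rewrite (dist_edge exy) (dist_edge exz) (dist_edge exw) => dy [] dz [] dw.
all: move=> zw yw yz.
all: first [ by constructor 1; apply: yz; nat_lia
           | by constructor 2; apply: yw; nat_lia
           | by constructor 3; apply: zw; nat_lia ].
Qed.

Lemma line_edge a b A x y : line a b A -> x \in A -> y \in A -> e x y ->
  dist a x + 1 + dist y b = dist a b \/ dist a y + 1 + dist x b = dist a b.
Proof.
case=> _ _ ab lin xA yA exy; have := lin x y xA yA; have := ab x xA.
have := ab y yA; rewrite (dist_edge exy); nat_lia.
Qed.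

(** Along the line, the distances from [u] to [x] and to [y] are the absolute
    values of two consecutive integers. *)
Lemma line_edge_not_level u a b A x y : line a b A ->
  u \in A -> x \in A -> y \in A -> e x y -> dist u x <> dist u y.
Proof.
case=> _ _ _ lin uA xA yA exy; have := lin u x uA xA; have := lin u y uA yA.
have := lin x y xA yA; rewrite (dist_edge exy); nat_lia.
Qed.

(** A line that starts at [b] and contains [u] approaches [u] with its first
    step. *)
Lemma line_start_closer u b a A b' : line b a A -> u \in A -> b != u ->
  e b b' -> dist u b' = dist u b + 1 -> b' \notin A.
Proof.
case=> _ _ _ lin uA neq_bu ebb' far; apply/negP => b'A.
have := lin b' u b'A uA.
rewrite (dist_edge ebb') (dist_sym b u) (dist_sym b' u).
case; first nat_lia.
move=> eq1; case/eqP: neq_bu; rewrite [RHS](@dist_eq0 u b) //; nat_lia.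
Qed.

(** The equation says that a shortest path from [b] to [x], the edge [xy] and a
    shortest path from [y] to [c] form together a shortest path. *)
Lemma edge_geodetic_pair b c : b != c ->
  (forall x y, e x y ->
    dist b x + 1 + dist y c = dist b c \/ dist b y + 1 + dist x c = dist b c) ->
  edge_geodetic_set e [set b; c].
Proof.
move=> neq_bc on_geo x y exy.
wlog xy : x y exy / dist b x + 1 + dist y c = dist b c.
  move=> W; case: (on_geo x y exy) => xy; first exact: W xy.
  have [||s [t [r [? ? ? ? yx]]]] := W y x => //; first by rewrite e_sym.
  by exists s, t, r; split; rewrite // /edge_on_path orbC.
have [p [ep lp sp]] := dist_walk b x; have [q [eq lq sq]] := dist_walk y c.
exists b, c, (b :: p ++ y :: q); rewrite !inE !eqxx orbT; split=> //.
  have lpq : last b (p ++ y :: q) = c by rewrite last_cat.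
  rewrite -[X in shortest_path e b X]lpq.
  apply: shortest_walk; first by rewrite cat_path ep /= lp exy.
  rewrite lpq size_cat /= sp sq -xy; nat_lia.
apply/orP; left; rewrite -cat_cons (lastI b p) lp cat_rcons.
exact: (@infix_infix _ (belast b p) [:: x; y] q).
Qed.

(** * Edges inside a level of an antipodal pair *)

Definition antipodal (u v : T) : Prop :=
  forall x, dist u x + dist x v = dist u v.

Lemma antipodal_sym u v : antipodal u v -> antipodal v u.
Proof.
move=> anti x; have := anti x.
rewrite (dist_sym v x) (dist_sym x u) (dist_sym v u); nat_lia.
Qed.

Lemma step_away u v x : antipodal u v -> x != v ->
  exists z, e x z /\ dist u z = dist u x + 1.
Proof.
move=> anti /step_closer[z [exz]]; exists z; split=> //.
have := anti x; have := anti z; nat_lia.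
Qed.

(** All distances are at most [dist u v]: the distances from [a] and [b] to [u]
    and [v] sum up to twice that value. A line that contains [u] and [v] is
    therefore not longer than the segment between them, and ends in them. *)
Lemma line_through_antipodes u v a b A : antipodal u v -> line a b A ->
  u \in A -> v \in A -> b != u -> b != v -> False.
Proof.
move=> anti [_ _ ab lin] uA vA /eqP bu /eqP bv.
have := lin u v uA vA; have := ab u uA; have := ab v vA.
have := dist_triangle a u b; have := dist_triangle a v b.
have := anti a; have := anti b.
have := @dist_eq0 u b; have := @dist_eq0 v b.
rewrite (dist_sym a u) (dist_sym b v).
move=> v0 u0; case: (posnP (dist v b)) => [/v0/esym//|?].
case: (posnP (dist u b)) => [/u0/esym//|?]; lia.
Qed.

Definition covered_by (A B C : seq T) : Prop := forall x y, e x y ->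
  [\/ x \in A /\ y \in A, x \in B /\ y \in B | x \in C /\ y \in C].

(** The neighbour [b'] of [b] one level further from [u] is neither on [A],
    which approaches [u], nor on [B]; so [C] leaves [b] through [b'] and reaches
    every [x] through [b']. If [x] were on [A] between [u] and [b], the distance
    from [b] to [x] would be the difference of their levels, which is too short
    for a detour by [b']. So [x] is between [a] and [u]. The edge [xy] serves to
    exclude [x = b], where [b'] and [y], both next to [b] on [C], would
    be the same vertex although their levels differ. *)
Lemma level_edge_near_apex u v a b c A B C x y :
  antipodal u v -> line a b A -> line b c C -> covered_by A B C ->
  u \in A -> b \notin B -> b != u -> b != v ->
  x \in A -> x \in C -> y \in C -> e x y -> dist u x = dist u y ->
  dist a x + dist x u = dist a u.
Proof.
move=> anti lA lC cov uA bB bu bv xA xC yC exy level.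
have [b' [ebb' up]] := step_away anti bv.
have b'A := line_start_closer (line_sym lA) uA bu ebb' up.
have b'C : b' \in C.
  case: (cov b b' ebb') => [] []; first by rewrite (negPf b'A).
    by rewrite (negPf bB).
  by [].
have xb : x != b.
  apply/eqP=> eq_xb; rewrite eq_xb in exy level.
  have := line_inj lC b'C yC; rewrite (dist_edge ebb') (dist_edge exy).
  by move=> /(_ erefl) eq_b'y; rewrite eq_b'y -level in up; nat_lia.
have closer : dist b x = 1 + dist b' x.
  have [_ _ _ /(_ b' x b'C xC)] := lC; rewrite (dist_edge ebb').
  case=> // eq1; suff: dist b x <> 0 by nat_lia.
  by move=> /dist_eq0 eq_bx; rewrite eq_bx eqxx in xb.
have [_ _ abA linA] := lA.
have := dist_triangle u x b'.
have := linA x u xA uA; have := abA x xA; have := abA u uA.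
rewrite (dist_sym x b') (dist_sym x b) (dist_sym x u); nat_lia.
Qed.

(** As [x] is neither [u] nor [v], it has neighbours in the level below and in
    the level above; with [y] these are three neighbours, and not all three of
    them are on [C]. *)
Lemma level_edge_branches u v b c A B C x y :
  antipodal u v -> line b c C -> covered_by A B C ->
  u \notin C -> v \notin C ->
  x \in C -> y \in C -> e x y -> dist u x = dist u y ->
  x \in A \/ x \in B.
Proof.
move=> anti lC cov uC vC xC yC exy level.
have xu : x != u by apply: contraNneq uC => <-.
have xv : x != v by apply: contraNneq vC => <-.
have [z [exz up]] := step_away anti xv.
have [w [exw down]] := step_closer xu.
case: (cov x z exz) => [] [xX zC]; [by left|by right|].
case: (cov x w exw) => [] [xX' wC]; [by left|by right|].
rewrite (dist_sym w) (dist_sym x) in down; exfalso.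
case: (line_degree_le2 lC xC yC zC wC exy exz exw) => [yz|yw|zw].
- by move: up; rewrite -yz -level; nat_lia.
- by move: down; rewrite -yw -level; nat_lia.
- by move: up; rewrite zw; nat_lia.
Qed.

(** By [level_edge_near_apex], applied to [A] and [u] and symmetrically to [B]
    and [v], the vertices [x] and [y] lie on the part of [A] from [u] to [a],
    whose levels are at most that of [a], or on the part of [B] from [a] to
    [v], whose levels are at least that of [a]. No two vertices of these parts
    have the same level. *)
Lemma level_edge_two_apexes u v a b c A B C x y :
  antipodal u v -> line a b A -> line a c B -> line b c C ->
  covered_by A B C -> b \notin B -> c \notin A ->
  u \in A -> v \in B -> u \notin C -> v \notin C ->
  x \in C -> y \in C -> e x y -> dist u x <> dist u y.
Proof.
move=> anti lA lB lC cov bB cA uA vB uC vC xC yC exy level.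
have [bC cC _ _] := lC.
have bu : b != u by apply: contraNneq uC => <-.
have bv : b != v by apply: contraNneq vC => <-.
have cu : c != u by apply: contraNneq uC => <-.
have cv : c != v by apply: contraNneq vC => <-.
have cov' : covered_by B A C.
  by move=> s t /cov[]; [constructor 2|constructor 1|constructor 3].
have side s t : s \in C -> t \in C -> e s t -> dist u s = dist u t ->
    (s \in A /\ dist a s + dist s u = dist a u)
    \/ (s \in B /\ dist a s + dist s v = dist a v).
  move=> sC tC est lev.
  case: (level_edge_branches anti lC cov uC vC sC tC est lev) => sX.
    left; split=> //.
    exact: (level_edge_near_apex anti lA lC cov uA bB bu bv sX sC tC est lev).
  right; split=> //.
  apply: (level_edge_near_apex (antipodal_sym anti) lB (line_sym lC) cov' vB
            cA cv cu sX sC tC est).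
  have := anti s; have := anti t; rewrite !(dist_sym v); nat_lia.
have [_ _ _ linA] := lA; have [_ _ _ linB] := lB.
have := dist_triangle x a y; have := anti a; have := anti x; have := anti y.
move: (dist_edge exy) (level).
rewrite (dist_sym x a) (dist_sym u a) (dist_sym u x) (dist_sym u y).
have eyx : e y x by rewrite e_sym.
case: (side x y xC yC exy level) => [] [xX];
  case: (side y x yC xC eyx (esym level)) => [] [yX]; try nat_lia.
  by have := linA x y xX yX; nat_lia.
by have := linB x y xX yX; nat_lia.
Qed.

(** An edge of [C] inside a level keeps [u] and [v] away from [C], hence from
    [b] and [c]; so they lie on [A] and [B], and on different ones. *)
Lemma three_lines_no_level_edge u v a b c A B C x y :
  antipodal u v -> u != v -> line a b A -> line a c B -> line b c C ->
  covered_by A B C -> b \notin B -> c \notin A ->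
  x \in C -> y \in C -> e x y -> dist u x <> dist u y.
Proof.
move=> anti uv lA lB lC cov bB cA xC yC exy level.
have level' : dist v x = dist v y.
  have := anti x; have := anti y; rewrite !(dist_sym v); nat_lia.
have uC : u \notin C by apply/negP => /(line_edge_not_level lC)/(_ xC yC exy).
have vC : v \notin C by apply/negP => /(line_edge_not_level lC)/(_ xC yC exy).
have [bC cC _ _] := lC.
have bu : b != u by apply: contraNneq uC => <-.
have bv : b != v by apply: contraNneq vC => <-.
have cu : c != u by apply: contraNneq uC => <-.
have cv : c != v by apply: contraNneq vC => <-.
have on_AB w w' : w != w' -> w \notin C -> w \in A \/ w \in B.
  move=> /step_closer[z [ewz _]] wC.
  by case: (cov w z ewz) => [] [wX _]; [left|right|rewrite wX in wC].
have cov' : covered_by B A C.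
  by move=> s t /cov[]; [constructor 2|constructor 1|constructor 3].
have vu : v != u by rewrite eq_sym.
case: (on_AB u v uv uC) => uX; case: (on_AB v u vu vC) => vX.
- exact: line_through_antipodes anti lA uX vX bu bv.
- exact: (level_edge_two_apexes anti lA lB lC cov bB cA uX vX uC vC xC yC exy).
- exact: (level_edge_two_apexes anti lB lA (line_sym lC) cov' cA bB
            uX vX uC vC xC yC exy level).
- exact: line_through_antipodes anti lB uX vX cu cv.
Qed.

(** * Geodetic pairs and strong edge-geodetic triples *)

(** If [a] is on [C], then [A] followed by [B] is a shortest path from [b] to
    [c], just as [C] is. *)
Lemma between_edge_geodetic a b c A B C : b != c ->
  line a b A -> line a c B -> line b c C -> covered_by A B C ->
  a \in C -> edge_geodetic_set e [set b; c].
Proof.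
move=> bc lA lB lC cov aC; apply: edge_geodetic_pair bc _ => x y exy.
have eyx : e y x by rewrite e_sym.
have [_ _ /(_ a aC) split_bc _] := lC.
case: (cov x y exy) => [] [xX yX].
- have := line_edge (line_sym lA) xX yX exy.
  have := dist_triangle x a c; have := dist_triangle y a c.
  have := dist_triangle b x c; have := dist_triangle b y c.
  have := dist_triangle x y c; have := dist_triangle y x c.
  rewrite (dist_edge exy) (dist_edge eyx); nat_lia.
- have := line_edge lB xX yX exy.
  have := dist_triangle b a x; have := dist_triangle b a y.
  have := dist_triangle b x c; have := dist_triangle b y c.
  have := dist_triangle x y c; have := dist_triangle y x c.
  rewrite (dist_edge exy) (dist_edge eyx); nat_lia.
- exact: line_edge lC xX yX exy.
Qed.

Lemma geodetic_pair_antipodal S : geodetic_set e S -> #|S| = 2 ->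
  exists u v, u != v /\ antipodal u v.
Proof.
move=> geo /eqP/cards2P[u [v [uv defS]]]; exists u, v; split=> // x.
have [s [t [r [sS tS st /shortest_path_line[_ _ on_st _] xr]]]] := geo x.
have := on_st x xr; move: sS tS st; rewrite defS !inE.
case/orP=> /eqP-> /orP[] /eqP->; rewrite ?eqxx // => _.
rewrite (dist_sym v x) (dist_sym x u) (dist_sym v u); nat_lia.
Qed.

Lemma level_edge_exists u v : u != v -> antipodal u v ->
  ~ edge_geodetic_set e [set u; v] -> exists x y, e x y /\ dist u x = dist u y.
Proof.
move=> uv anti not_geo.
case: (boolP [exists x, exists y, e x y && (dist u x == dist u y)]).
  by case/existsP=> x /existsP[y /andP[exy /eqP]]; exists x, y.
move=> none; case: not_geo; apply: edge_geodetic_pair uv _ => x y exy.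
have /eqP : dist u x != dist u y.
  apply: contra none => level.
  by apply/existsP; exists x; apply/existsP; exists y; rewrite exy.
have := dist_triangle u x y; have := dist_triangle u y x.
have := anti x; have := anti y.
rewrite (dist_sym y x) (dist_edge exy); nat_lia.
Qed.

Lemma edge_on_path_mem (x y : T) s : edge_on_path x y s -> x \in s /\ y \in s.
Proof.
by case/orP=> /mem_infix sub; split; apply: sub; rewrite !inE eqxx ?orbT.
Qed.

Lemma strong_triple_lines S : strong_edge_geodetic_set e S -> #|S| = 3 ->
  exists a b c A B C, [/\ a != b, a != c & b != c] /\
    [/\ line a b A, line a c B, line b c C & covered_by A B C].
Proof.
case=> P [geo cov] cardS.
have := cardE S; have := enum_uniq S; have : S =i enum S.
  by move=> z; rewrite mem_enum.
rewrite cardS; case: (enum S) => [|a [|b [|c []]]] //= memS uS _.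
move: uS; rewrite !inE negb_or andbT => /andP[/andP[ab ac] bc].
have [aS bS cS] : [/\ a \in S, b \in S & c \in S].
  by rewrite !memS !inE !eqxx !orbT.
have [pab rab] := geo a b aS bS ab; have [pac rac] := geo a c aS cS ac.
have [pbc rbc] := geo b c bS cS bc.
exists a, b, c, (P a b), (P a c), (P b c); split=> //.
split; try exact: shortest_path_line.
move=> x y /cov[s [t [sS tS st /edge_on_path_mem[]]]].
move: sS tS st; rewrite !memS !inE.
case/or3P=> /eqP-> /or3P[] /eqP->; rewrite ?eqxx // => _;
  rewrite ?rab ?rac ?rbc ?mem_rev => xs ys;
  by [constructor 1|constructor 2|constructor 3].
Qed.

(** The edge inside a level may be on any of the three lines; permuting the
    names of the triple brings it to the line called [C] above. *)
Lemma no_geodetic_pair_with_strong_triple S S' :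
  geodetic_set e S -> #|S| = 2 ->
  strong_edge_geodetic_set e S' -> #|S'| = 3 ->
  ~ forall W, edge_geodetic_set e W -> 3 <= #|W|.
Proof.
move=> geo cardS strong cardS' large.
have no_pair s t : ~ edge_geodetic_set e [set s; t].
  by move=> /large; rewrite cards2; case: (s != t).
have [u [v [uv anti]]] := geodetic_pair_antipodal geo cardS.
have [x [y [exy level]]] := level_edge_exists uv anti (@no_pair u v).
have [a [b [c [A [B [C [[ab ac bc] [lA lB lC cov]]]]]]]] :=
  strong_triple_lines strong cardS'.
have covA : covered_by A C B.
  by move=> s t /cov[]; [constructor 1|constructor 3|constructor 2].
have covB : covered_by B C A.
  by move=> s t /cov[]; [constructor 3|constructor 1|constructor 2].
have aC : a \notin C.
  by apply/negP => /(between_edge_geodetic bc lA lB lC cov)/no_pair.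
have bB : b \notin B.
  by apply/negP => /(between_edge_geodetic ac (line_sym lA) lC lB covA)/no_pair.
have cA : c \notin A.
  by apply/negP =>
    /(between_edge_geodetic ab (line_sym lB) (line_sym lC) lA covB)/no_pair.
case: (cov x y exy) => [] [xX yX].
- exact: (three_lines_no_level_edge anti uv (line_sym lB) (line_sym lC) lA covB
            aC bB xX yX exy level).
- exact: (three_lines_no_level_edge anti uv (line_sym lA) lC lB covA
            aC cA xX yX exy level).
- exact: (three_lines_no_level_edge anti uv lA lB lC cov bB cA xX yX exy level).
Qed.

End Distance.

Theorem theorem7 (d : nat) (hd : 3 <= d) :
  ~ exists (T : finType) (e : rel T),
      [/\ simple_graph e, connected_graph e &
          [/\ geodetic_number e 2, edge_geodetic_number e 3,
              strong_edge_geodetic_number e 3 & meg_number e d]].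
Proof.
case=> T [e [[e_sym eirr] econn [gn egn segn _]]].
case: gn egn segn => [[S geoS cardS] _] [_ large] [[S' strong cardS'] _].
exact: (no_geodetic_pair_with_strong_triple e_sym eirr econn geoS cardS strong
  cardS' large).
Qed.
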